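(* Let $a,b,c$ be non-negative real numbers with $a+b+c=1$. For each non-negative integer $n$, let $R_n(a,b,c)$ be the random hexagonal cactus with $n$ hexagons, and let $E(i_n(a,b,c))$ denote the expected value of the number of independent sets of $R_n(a,b,c)$. Then the generating function $I_{a,b,c}(x)=\sum_{n=0}^{\infty}E(i_n(a,b,c))x^n$ satisfies \[ I_{a,b,c}(x)=\frac{1+13x-3ax-7bx-5cx+25ax^2-11bx^2+7cx^2}{1-5x-3ax-7bx-5cx-25ax^2+11bx^2-7cx^2}. \]
   Context: An independent set of a graph is a set of vertices no two of which are adjacent (the empty set counts as an independent set; the empty graph has exactly one independent set). A hexagon is a cycle $C_6$. The random hexagonal cactus $R_n(a,b,c)$, for non-negative reals $a,b,c$ with $a+b+c=1$, is defined recursively: $R_0(a,b,c)$ is the empty graph; $R_1(a,b,c)$ is a hexagon; $R_2(a,b,c)$ is obtained from two hexagons by identifying one vertex of one with one vertex of the other. For $n\ge 3$, label the hexagons of $R_{n-1}(a,b,c)$ as $1,\dots,n-1$ consecutively along the chain; the $(n-1)$-th hexagon contains a cut vertex $v$ (shared with the $(n-2)$-th hexagon). Then $R_n(a,b,c)$ is obtained from $R_{n-1}(a,b,c)$ and a new hexagon $H$ by identifying a vertex of $H$ with a vertex of the $(n-1)$-th hexagon that is at distance one from $v$ with probability $a$, at distance two from $v$ with probability $b$, or at distance three from $v$ with probability $c$ (distances measured in the $(n-1)$-th hexagon), independently at each step. *)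

(* Defs.v *)
From HB Require Import structures.
From mathcomp Require Import all_boot all_order all_algebra.
From mathcomp Require Import boolp reals.

Set Implicit Arguments.
Unset Strict Implicit.
Unset Printing Implicit Defensive.

Import Order.TTheory GRing.Theory Num.Theory.

Section FormalPowerSeries.
Local Open Scope ring_scope.

Record fps (R : Type) := Fps { fcoef : nat -> R }.

Lemma fpsP (R : Type) (f g : fps R) : fcoef f =1 fcoef g -> f = g.
Proof. by case: f g => [f] [g] /= /funext ->. Qed.

HB.instance Definition _ (R : Type) := gen_eqMixin (fps R).
HB.instance Definition _ (R : Type) := gen_choiceMixin (fps R).

Section Zmod.
Variable R : zmodType.
Implicit Types f g h : fps R.

Definition fps_zero : fps R := Fps (fun=> 0).
Definition fps_opp f : fps R := Fps (fun n => - fcoef f n).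
Definition fps_add f g : fps R := Fps (fun n => fcoef f n + fcoef g n).

Fact fps_addA : associative fps_add.
Proof. by move=> f g h; apply: fpsP => n /=; rewrite addrA. Qed.
Fact fps_addC : commutative fps_add.
Proof. by move=> f g; apply: fpsP => n /=; rewrite addrC. Qed.
Fact fps_add0 : left_id fps_zero fps_add.
Proof. by move=> f; apply: fpsP => n /=; rewrite add0r. Qed.
Fact fps_addN : left_inverse fps_zero fps_opp fps_add.
Proof. by move=> f; apply: fpsP => n /=; rewrite addNr. Qed.

HB.instance Definition _ :=
  GRing.isZmodule.Build (fps R) fps_addA fps_addC fps_add0 fps_addN.
End Zmod.

Definition poly_fps (R : nzRingType) (p : {poly R}) : fps R :=
  Fps (fun n => p`_n).

Section ComRing.
Variable R : comNzRingType.
Implicit Types f g h : fps R.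

Definition fps_one : fps R := Fps (fun n => (n == 0)%:R).
Definition fps_mul f g : fps R :=
  Fps (fun n => \sum_(i < n.+1) fcoef f i * fcoef g (n - i)).

Definition fps_trunc m f : {poly R} := \poly_(i < m) fcoef f i.

Lemma coef_fps_trunc m f n :
  (fps_trunc m f)`_n = if (n < m)%N then fcoef f n else 0.
Proof. by rewrite coef_poly. Qed.

Lemma fps_mulE m f g n : (n < m)%N ->
  fcoef (fps_mul f g) n = (fps_trunc m f * fps_trunc m g)`_n.
Proof.
move=> nm; rewrite coefM /=; apply: eq_bigr => i _.
rewrite !coef_fps_trunc (leq_ltn_trans _ nm) ?leq_ord //.
by rewrite (leq_ltn_trans (leq_subr _ _) nm).
Qed.

Fact fps_mulC : commutative fps_mul.
Proof. by move=> f g; apply: fpsP => n; rewrite !(fps_mulE _ _ (ltnSn n)) mulrC. Qed.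

Fact fps_mulA : associative fps_mul.
Proof.
move=> f g h; apply: fpsP => n.
pose t := fps_trunc n.+1.
transitivity ((t f * (t g * t h))`_n).
  rewrite coefM; apply: eq_bigr => i _.
  rewrite coef_fps_trunc ltn_ord; congr (_ * _).
  by rewrite (@fps_mulE n.+1) // ltnS leq_subr.
rewrite mulrA coefM; apply: eq_bigr => i _.
by rewrite coef_fps_trunc ltnS leq_subr -(@fps_mulE n.+1).
Qed.

Fact fps_mul1 : left_id fps_one fps_mul.
Proof.
move=> f; apply: fpsP => n /=.
rewrite big_ord_recl /= mul1r subn0 big1 ?addr0 // => i _.
by rewrite mul0r.
Qed.

Fact fps_mulDl : left_distributive fps_mul (@fps_add R).
Proof.
move=> f g h; apply: fpsP => n /=; rewrite -big_split /=.
by apply: eq_bigr => i _; rewrite mulrDl.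
Qed.

Fact fps_one_neq0 : fps_one != 0.
Proof.
apply/eqP => /(congr1 (fun f => fcoef f 0)) /= /eqP.
by rewrite oner_eq0.
Qed.

HB.instance Definition _ := GRing.Zmodule_isComNzRing.Build (fps R)
  fps_mulA fps_mulC fps_mul1 fps_mulDl fps_one_neq0.
End ComRing.

Section UnitRing.
Variable R : comUnitRingType.
Implicit Types f g : fps R.

Definition fps_unit : {pred fps R} :=
  fun f => fcoef f 0 \is a GRing.unit.

(* The first n coefficients of the inverse of f, determined one after the     *)
(* other by the equations \sum_(i <= m) f_(m - i) g_i = [m = 0].              *)
Fixpoint fps_inv_seq f n : seq R :=
  if n is m.+1 then
    let s := fps_inv_seq f m in
    rcons s ((fcoef f 0)^-1 *
             ((m == 0)%:R - \sum_(i < m) fcoef f (m - i) * s`_i))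
  else [::].

Definition fps_inv f : fps R :=
  if fps_unit f then Fps (fun n => (fps_inv_seq f n.+1)`_n) else f.

Lemma size_fps_inv_seq f n : size (fps_inv_seq f n) = n.
Proof. by elim: n => //= n IHn; rewrite size_rcons IHn. Qed.

Lemma nth_fps_inv_seq f m n i : (i < n <= m)%N ->
  (fps_inv_seq f m)`_i = (fps_inv_seq f n)`_i.
Proof.
case/andP=> lt_in; elim: m => [|m IHm]; first by case: n lt_in.
rewrite leq_eqVlt => /predU1P[-> //|]; rewrite ltnS => le_nm.
by rewrite /= nth_rcons size_fps_inv_seq (leq_trans lt_in) // IHm.
Qed.

Fact fps_mulV : {in fps_unit, left_inverse 1 fps_inv *%R}.
Proof.
move=> f f_unit; rewrite mulrC; apply: fpsP => n.
have f0 : fcoef f 0 \is a GRing.unit by [].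
rewrite /fps_inv; have -> : fps_unit f by [].
rewrite [LHS](reindex_inj rev_ord_inj) /=.
under eq_bigr => i _ do rewrite subSS.
under eq_bigr => i _ do rewrite subKn ?leq_ord //.
rewrite big_ord_recr /= subnn nth_rcons size_fps_inv_seq ltnn eqxx mulVKr //.
set S := \sum_(_ < _) _; set S' := \sum_(_ < _) _.
suff -> : S = S' by rewrite addrC subrK.
by apply: eq_bigr => i _; rewrite -(@nth_fps_inv_seq _ n i.+1) ?ltnSn /=.
Qed.

Fact fps_unitPl f g : g * f = 1 -> fps_unit f.
Proof.
move/(congr1 (fun h => fcoef h 0)) => /=; rewrite big_ord1 /= => gf1.
by apply/unitrP; exists (fcoef g 0); rewrite gf1 mulrC gf1.
Qed.

Fact fps_inv_out : {in [predC fps_unit], fps_inv =1 id}.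
Proof. by move=> f; rewrite inE /fps_inv => /negPf fU; rewrite [fps_unit f]fU. Qed.

HB.instance Definition _ := GRing.ComNzRing_hasMulInverse.Build (fps R)
  fps_mulV fps_unitPl fps_inv_out.
End UnitRing.

End FormalPowerSeries.

Record sgraph := SGraph {
  vertex :> finType;
  adj : rel vertex;
  adj_sym : symmetric adj;
  adj_irr : irreflexive adj }.

Definition independent (G : sgraph) (S : {set G}) : bool :=
  [forall x in S, forall y in S, ~~ adj x y].

Definition num_indep (G : sgraph) : nat := #|[set S : {set G} | independent S]|.

(* Length of a shortest walk from x to y, or #|G| if there is none.           *)
Definition gdist (G : sgraph) (x y : G) : nat :=
  find (fun k => [exists p : k.-tuple G, path (@adj G) x p && (last x p == y)])
       (iota 0 #|G|).

Definition void_adj : rel void := fun _ _ => false.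
Fact void_adj_sym : symmetric void_adj. Proof. by []. Qed.
Fact void_adj_irr : irreflexive void_adj. Proof. by []. Qed.
Definition empty_graph : sgraph := SGraph void_adj_sym void_adj_irr.

Definition hex_adj : rel 'I_6 := fun i j => (j == ordS i) || (i == ordS j).
Fact hex_adj_sym : symmetric hex_adj.
Proof. by move=> i j; rewrite /hex_adj orbC. Qed.
Fact hex_adj_irr : irreflexive hex_adj.
Proof. by case=> [[|[|[|[|[|[|m]]]]]] lt_m6]. Qed.
Definition hexagon : sgraph := SGraph hex_adj_sym hex_adj_irr.

Lemma gdist_hexagon (i : hexagon) : gdist (ord0 : hexagon) i = minn i (6 - i).
Proof.
pose f (x : 'I_6) := minn x (6 - x).
have lip (x y : 'I_6) : hex_adj x y -> f y <= (f x).+1.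
  by case: x y => [[|[|[|[|[|[|m]]]]]] ?] // [[|[|[|[|[|[|n]]]]]] ?].
have far (x : 'I_6) p : path hex_adj x p -> f (last x p) <= f x + size p.
  elim: p x => [|y p IHp] x /=; first by rewrite addn0.
  case/andP=> xy /IHp/leq_trans; apply.
  by rewrite addnS -addSn leq_add2r lip.
pose P (j : 'I_6) (k : nat) := [exists p : k.-tuple hexagon,
  path (@adj hexagon) ord0 p && (last (ord0 : hexagon) p == j)].
have P_far k : P i k -> f i <= k.
  by case/existsP=> p /andP[/far]; rewrite size_tuple => le_k /eqP <-.
have PI (j : 'I_6) k (p : k.-tuple 'I_6) :
    path hex_adj ord0 p && (last ord0 p == j) -> P j k.
  by move=> p_path; apply/existsP; exists p.
have Pf : P i (f i).
  have v (n : nat) : n < 6 -> {x : 'I_6 | x = n :> nat}.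
    by move=> lt_n6; exists (Ordinal lt_n6).
  have [x1 e1] := v 1 isT; have [x2 e2] := v 2 isT; have [x3 e3] := v 3 isT.
  have [x4 e4] := v 4 isT; have [x5 e5] := v 5 isT.
  case: i {P_far} => [[|[|[|[|[|[|m]]]]]] lt_i] //.
  - exact: (PI _ 0 [tuple]).
  - by apply: (PI _ 1 [tuple x1]); rewrite /= /hex_adj -!val_eqE /= e1.
  - by apply: (PI _ 2 [tuple x1; x2]); rewrite /= /hex_adj -!val_eqE /= e1 e2.
  - apply: (PI _ 3 [tuple x1; x2; x3]).
    by rewrite /= /hex_adj -!val_eqE /= e1 e2 e3.
  - by apply: (PI _ 2 [tuple x5; x4]); rewrite /= /hex_adj -!val_eqE /= e5 e4.
  - by apply: (PI _ 1 [tuple x5]); rewrite /= /hex_adj -!val_eqE /= e5.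
have f_lt6 : f i < 6 by rewrite /f; case: i {P_far Pf} => [[|[|[|[|[|[|m]]]]]] ?].
rewrite /gdist card_ord -/(P i) -/(f i).
have hasP : has (P i) (iota 0 6) by apply/hasP; exists (f i); rewrite ?mem_iota.
apply/eqP; rewrite eqn_leq; apply/andP; split.
  rewrite leqNgt; apply/negP => /(before_find 0).
  by rewrite nth_iota // add0n Pf.
have := nth_find 0 hasP; rewrite nth_iota ?add0n; first exact: P_far.
by rewrite -[X in _ < X](size_iota 0 6) -has_find.
Qed.

(* A graph together with a cyclic labelling by 'I_6 of the vertices of its    *)
(* last hexagon; in a chain of at least two hexagons, the label 0 is carried  *)
(* by the cut vertex shared with the previous hexagon.                        *)
Record chain := Chain {
  chain_graph :> sgraph;
  last_hex : 'I_6 -> chain_graph }.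

Section Attach.
Variables (C : chain) (p : 'I_6).

(* A new hexagon is glued to C by identifying its vertex 0 with the vertex p  *)
(* of the last hexagon of C; the other five vertices of the new hexagon are   *)
(* fresh, fresh vertex j : 'I_5 being vertex j + 1 of the new hexagon.        *)
Definition attach_vertex : finType := (C + 'I_5)%type.

Definition attach_hex (i : 'I_6) : attach_vertex :=
  if unlift ord0 i is Some j then inr j else inl (last_hex C p).

Definition attach_adj : rel attach_vertex := fun x y =>
  match x, y with inl u, inl v => adj u v | _, _ => false end
  || [exists i, exists j,
        [&& hex_adj i j, x == attach_hex i & y == attach_hex j]].

Fact attach_adj_sym : symmetric attach_adj.
Proof.
move=> x y; rewrite /attach_adj; congr (_ || _).
  by case: x y => [u|u] [v|v] //; rewrite adj_sym.
apply/existsP/existsP => -[i /existsP[j /and3P[ij xi yj]]];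
by exists j; apply/existsP; exists i; rewrite hex_adj_sym ij xi yj.
Qed.

Lemma attach_hex_inj : injective attach_hex.
Proof.
move=> i j; rewrite /attach_hex.
by case: unliftP => [i'|] ->; case: unliftP => [j'|] -> // [->].
Qed.

Fact attach_adj_irr : irreflexive attach_adj.
Proof.
move=> x; apply/norP; split; first by case: x => // u; rewrite adj_irr.
apply/existsP => -[i /existsP[j /and3P[ij /eqP -> /eqP/attach_hex_inj eq_ij]]].
by rewrite eq_ij hex_adj_irr in ij.
Qed.

Definition attach : chain :=
  @Chain (SGraph attach_adj_sym attach_adj_irr) attach_hex.
End Attach.

Definition one_hexagon : chain := @Chain hexagon id.

(* By the symmetry of the hexagon it does not matter which vertex of the      *)
(* first hexagon is used.                                                     *)
Definition two_hexagons : chain := attach one_hexagon ord0.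

(* The chain of n hexagons in which w lists the successive attachment         *)
(* positions: the (k + 3)-rd hexagon is glued at the vertex w_k of the        *)
(* (k + 2)-nd one.  For n <= 2 there is no position to choose.                *)
Definition cactus (n : nat) (w : (n - 2).-tuple 'I_6) : sgraph :=
  match n with
  | 0 => empty_graph
  | 1 => one_hexagon
  | _ => foldl attach two_hexagons w
  end.

Section RandomCactus.
Local Open Scope ring_scope.
Variable R : realType.

(* mu is a law for the attachment position of a new hexagon: only the         *)
(* probabilities of the distances to the cut vertex 0 are prescribed.  There  *)
(* are two positions at distance 1 and two at distance 2; how a and b are     *)
(* shared between them is left free.                                          *)
Definition attach_law (a b c : R) (mu : 'I_6 -> R) : Prop :=
  [/\ (forall p, 0 <= mu p) /\ \sum_p mu p = 1,
      \sum_(p | gdist (ord0 : hexagon) p == 1) mu p = a,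
      \sum_(p | gdist (ord0 : hexagon) p == 2) mu p = b &
      \sum_(p | gdist (ord0 : hexagon) p == 3) mu p = c].

(* The steps are independent, the k-th one having law mu k.                   *)
Definition cactus_prob (mu : nat -> 'I_6 -> R) n (w : (n - 2).-tuple 'I_6) : R :=
  \prod_(k < n - 2) mu k (tnth w k).

Definition expected_indep (mu : nat -> 'I_6 -> R) (n : nat) : R :=
  \sum_(w : (n - 2).-tuple 'I_6)
    cactus_prob mu w * (num_indep (cactus w))%:R.

Definition indep_gf (mu : nat -> 'I_6 -> R) : fps R := Fps (expected_indep mu).

End RandomCactus.

(* Main.v *)
(** Gluing a hexagon at a vertex [v] of a graph turns each independent set
    containing [v] into 5 independent sets and each one avoiding [v] into 13.
    The new numbers of independent sets (in total, and through the next
    attachment vertex) are thus linear in the old ones, with coefficients that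
    depend only on the distance from the next attachment vertex to the cut
    vertex.  Averaging over the positions makes the expectations evolve by a
    constant 2x2 matrix, so they satisfy a linear recurrence of order two given
    by its characteristic polynomial, whose reciprocal polynomial is
    the denominator. *)
Require Import Defs.
From HB Require Import structures.
From mathcomp Require Import all_boot all_order all_algebra.
From mathcomp Require Import boolp reals.
From mathcomp Require Import ring lra.
Import Order.TTheory GRing.Theory Num.Theory.
Local Open Scope ring_scope.

(** * Sums over tuples *)

Lemma big_tupleS (V : Type) (idx : V) (op : Monoid.com_law idx) (T : finType)
    n (F : n.+1.-tuple T -> V) :
  \big[op/idx]_w F w =
  \big[op/idx]_x \big[op/idx]_(w : n.-tuple T) F (cons_tuple x w).
Proof.
rewrite pair_big /=.
rewrite (reindex (fun xw : T * n.-tuple T => cons_tuple xw.1 xw.2)) //.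
exists (fun w : n.+1.-tuple T => (thead w, behead_tuple w)) => [[x w] _|w _] /=.
  by congr (_, _); apply: val_inj.
by rewrite [RHS]tuple_eta; apply: val_inj.
Qed.

Lemma big_tuple0 (V : Type) (idx : V) (op : Monoid.com_law idx) (T : finType)
    (F : 0.-tuple T -> V) :
  \big[op/idx]_w F w = F [tuple].
Proof. by rewrite (big_pred1 [tuple]) // => w; rewrite [w]tuple0 /= eqxx. Qed.

(** * Independent sets of one hexagon *)

Definition hex_indep (s : 6.-tuple bool) : bool :=
  [forall i, ~~ (tnth s i && tnth s (ordS i))].

Lemma hex_indepP (s : 6.-tuple bool) :
  reflect (forall i j, hex_adj i j -> ~~ (tnth s i && tnth s j)) (hex_indep s).
Proof.
apply: (iffP forallP) => [ok i j /orP[] /eqP -> //|ok i].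
  by rewrite andbC.
by apply: ok; rewrite /hex_adj eqxx.
Qed.

Lemma hex_indepE (s : 6.-tuple bool) (x := nth false s) :
  hex_indep s =
  [&& ~~ (x 0 && x 1), ~~ (x 1 && x 2), ~~ (x 2 && x 3), ~~ (x 3 && x 4),
      ~~ (x 4 && x 5) & ~~ (x 5 && x 0)]%N.
Proof.
have -> : hex_indep s = \big[andb/true]_i ~~ (tnth s i && tnth s (ordS i)).
  by rewrite big_andE.
by rewrite !big_ord_recl big_ord0 /= !(tnth_nth false) /= andbT.
Qed.

(* The number of ways to extend a choice [b] at the vertex 0 of a hexagon to an
   independent set satisfying [Q]. *)
Definition hex_count (b : bool) (Q : pred (6.-tuple bool)) : nat :=
  (\sum_(t : 5.-tuple bool) (hex_indep (cons_tuple b t) && Q (cons_tuple b t)))%N.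

(* [bigop] is locked; this form of the sum can be evaluated. *)
Fixpoint bool_tuple_sum n : (n.-tuple bool -> nat) -> nat :=
  if n is m.+1 return (n.-tuple bool -> nat) -> nat then
    fun F => (bool_tuple_sum m (fun t => F (cons_tuple true t)) +
              bool_tuple_sum m (fun t => F (cons_tuple false t)))%N
  else fun F => F [tuple].

Lemma bool_tuple_sumE n (F : n.-tuple bool -> nat) :
  (\sum_t F t)%N = bool_tuple_sum n F.
Proof.
elim: n F => [|n IHn] F /=; first by rewrite big_tuple0.
by rewrite big_tupleS big_bool /= !IHn.
Qed.

(** Choosing the vertex 0 excludes both its neighbours and leaves a path on 3 vertices, with 5
    independent sets; avoiding it leaves a path on 5 vertices, with 13. *)
Lemma hex_countT b : hex_count b xpredT = if b then 5%N else 13%N.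
Proof.
rewrite /hex_count; under eq_bigr do rewrite hex_indepE.
by rewrite bool_tuple_sumE; case: b; vm_compute.
Qed.

Lemma hex_count_at b (q : 'I_6) : hex_count b (fun s => tnth s q) =
  if b then nth 0%N [:: 5; 0; 2; 1; 2; 0]%N q
  else nth 0%N [:: 0; 5; 3; 4; 3; 5]%N q.
Proof.
rewrite /hex_count; under eq_bigr do rewrite hex_indepE (tnth_nth false).
rewrite bool_tuple_sumE.
by case: b; case: q => [[|[|[|[|[|[|m]]]]]] lt_q] //; vm_compute.
Qed.

(** * Independent sets after gluing a hexagon *)

Lemma card_indep_sum (G : sgraph) (Q : pred {set G}) :
  #|[set S : {set G} | independent S && Q S]| =
  (\sum_(S : {set G}) (independent S && Q S))%N.
Proof. by rewrite cardsE -sum1_card big_mkcond /=; apply: eq_bigr => S _. Qed.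

Definition indep_at (C : chain) (p : 'I_6) : nat :=
  #|[set S : {set C} | independent S && (last_hex C p \in S)]|.
Definition indep_off (C : chain) (p : 'I_6) : nat :=
  #|[set S : {set C} | independent S && (last_hex C p \notin S)]|.

Lemma num_indep_split (C : chain) p : num_indep C = (indep_at C p + indep_off C p)%N.
Proof.
rewrite /num_indep -(cardsID [set S : {set C} | last_hex C p \in S]).
by congr (_ + _)%N; apply: eq_card => S; rewrite !inE // andbC.
Qed.

Section AttachCount.
Variables (C : chain) (p : 'I_6).

Definition trace (U : {set attach C p}) : 6.-tuple bool :=
  [tuple attach_hex C p i \in U | i < 6].

Definition join_set (St : {set C} * 5.-tuple bool) : {set attach C p} :=
  [set x : attach C p |
    match x with inl u => u \in St.1 | inr j => tnth St.2 j end].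

Lemma join_set_bij : bijective join_set.
Proof.
exists (fun U : {set attach C p} =>
  ([set u | (inl u : attach C p) \in U],
   [tuple (inr j : attach C p) \in U | j < 5])).
  move=> [S t]; congr (_, _); first by apply/setP => u; rewrite !inE.
  by apply: eq_from_tnth => j; rewrite tnth_mktuple inE.
by move=> U; apply/setP => -[u|j]; rewrite !inE //= tnth_mktuple.
Qed.

Lemma trace_join S t :
  trace (join_set (S, t)) = cons_tuple (last_hex C p \in S) t.
Proof.
apply: eq_from_tnth => i; rewrite tnth_mktuple inE /attach_hex.
by case: unliftP => [j|] -> //=; rewrite tnthS.
Qed.

(** Every edge of the glued graph lies in [C] or in the new hexagon, and these share only the gluing
    vertex, whose status is already fixed by [S]. *)
Lemma independent_join S t :
  independent (join_set (S, t)) =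
  independent S && hex_indep (cons_tuple (last_hex C p \in S) t).
Proof.
rewrite -trace_join; set U := join_set _.
have inU u : ((inl u : attach C p) \in U) = (u \in S) by rewrite inE.
apply/idP/andP => [ind|[indS /hex_indepP indH]].
  have {}ind (x y : attach C p) : x \in U -> y \in U -> ~~ adj x y.
    by move=> xU yU; have /forall_inP/(_ _ xU)/forall_inP/(_ _ yU) := ind.
  split.
    apply/forall_inP => u uS; apply/forall_inP => v vS.
    by have := ind (inl u) (inl v); rewrite !inU => /(_ uS vS) /norP[].
  apply/hex_indepP => i j ij; rewrite !tnth_mktuple; apply/negP => /andP[iU jU].
  have /norP[_ /negP] := ind _ _ iU jU; apply.
  by apply/existsP; exists i; apply/existsP; exists j; rewrite ij !eqxx.
apply/forall_inP => x xU; apply/forall_inP => y yU; apply/norP; split.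
  case: x y xU yU => [u|//] [v|//]; rewrite !inU => uS vS.
  by have /forall_inP/(_ _ uS)/forall_inP/(_ _ vS) := indS.
apply/existsP => -[i /existsP[j /and3P[ij /eqP xi /eqP yj]]].
by have := indH _ _ ij; rewrite !tnth_mktuple -xi -yj xU yU.
Qed.

(** For fixed [S], the number of extensions depends only on whether [S] contains the gluing vertex.
    Leaving [Q] free covers both the total count and the count through the next attachment
    vertex. *)
Lemma attach_count (Q : pred (6.-tuple bool)) :
  #|[set U : {set attach C p} | independent U && Q (trace U)]| =
  (indep_at C p * hex_count true Q + indep_off C p * hex_count false Q)%N.
Proof.
rewrite (@card_indep_sum (attach C p) (fun U => Q (trace U))).
rewrite (reindex join_set) /=; last exact/onW_bij/join_set_bij.
rewrite /indep_at /indep_off !card_indep_sum !big_distrl -big_split /=.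
rewrite -(pair_big xpredT xpredT (fun S t =>
  independent (join_set (S, t)) && Q (trace (join_set (S, t))) : nat)) /=.
apply: eq_bigr => S _.
under eq_bigr do rewrite independent_join trace_join -andbA.
rewrite /hex_count; case: (independent S); last by rewrite big1.
by case: (_ \in S); rewrite /= mul1n mul0n ?addn0.
Qed.

Lemma num_indep_attach :
  num_indep (attach C p) = (indep_at C p * 5 + indep_off C p * 13)%N.
Proof.
have := attach_count xpredT; rewrite !hex_countT => <-.
by apply: eq_card => U; rewrite !inE andbT.
Qed.

Lemma indep_at_attach q :
  indep_at (attach C p) q =
  (indep_at C p * nth 0%N [:: 5; 0; 2; 1; 2; 0]%N q +
   indep_off C p * nth 0%N [:: 0; 5; 3; 4; 3; 5]%N q)%N.
Proof.
have := attach_count (fun s => tnth s q); rewrite !hex_count_at => <-.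
by apply: eq_card => U; rewrite !inE tnth_mktuple.
Qed.
End AttachCount.

(** * Starting values: one hexagon and the empty graph *)

Lemma one_hexagon_count (Q : pred (6.-tuple bool)) :
  #|[set S : {set one_hexagon} |
      independent S && Q [tuple i \in S | i < 6]]| =
  (hex_count true Q + hex_count false Q)%N.
Proof.
rewrite (@card_indep_sum one_hexagon (fun S => Q [tuple i \in S | i < 6])).
pose f (s : 6.-tuple bool) : {set one_hexagon} :=
  [set i : 'I_6 | tnth s i].
have fK : cancel f (fun S : {set 'I_6} => [tuple i \in S | i < 6]).
  by move=> s; apply: eq_from_tnth => i; rewrite tnth_mktuple inE.
have f_bij : bijective f.
  exists (fun S : {set 'I_6} => [tuple i \in S | i < 6]) => // S.
  by apply/setP => i; rewrite inE tnth_mktuple.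
rewrite (reindex f) /=; last exact/onW_bij.
transitivity (\sum_(s : 6.-tuple bool) (hex_indep s && Q s))%N; last first.
  by rewrite big_tupleS big_bool.
apply: eq_bigr => s _; rewrite fK; congr (nat_of_bool (_ && _)).
apply/idP/hex_indepP => [ind i j ij|ind].
  apply/negP => /andP[si sj].
  have /forall_inP/(_ i) := ind; rewrite inE => /(_ si)/forall_inP/(_ j).
  by rewrite inE => /(_ sj)/negP.
apply/forall_inP => i; rewrite inE => si; apply/forall_inP => j.
by rewrite inE => sj; apply/negP => /ind; rewrite si sj.
Qed.

Lemma num_indep_one_hexagon : num_indep one_hexagon = 18%N.
Proof.
transitivity (hex_count true xpredT + hex_count false xpredT)%N.
  by rewrite -one_hexagon_count; apply: eq_card => S; rewrite !inE andbT.
by rewrite !hex_countT.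
Qed.

Lemma indep_at_one_hexagon : indep_at one_hexagon ord0 = 5%N.
Proof.
transitivity (hex_count true (fun s => tnth s ord0) +
              hex_count false (fun s => tnth s ord0))%N.
  rewrite -one_hexagon_count; apply: eq_card => S.
  by rewrite !inE tnth_mktuple.
by rewrite !hex_count_at.
Qed.

Lemma indep_off_one_hexagon : indep_off one_hexagon ord0 = 13%N.
Proof.
apply/eqP; rewrite -(eqn_add2l (indep_at one_hexagon ord0)).
by rewrite -num_indep_split num_indep_one_hexagon indep_at_one_hexagon.
Qed.

Lemma num_indep_empty : num_indep empty_graph = 1%N.
Proof.
rewrite /num_indep (_ : [set S | _] = [set set0]) ?cards1 //.
apply/setP => S; rewrite !inE.
have -> : S = set0 by apply/setP => -[].
by rewrite eqxx; apply/forall_inP => -[].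
Qed.

(** * Expectations along the random chain *)

Section Expectation.
Context {R : realType} {a b c : R}.
Hypothesis habc : a + b + c = 1.
Implicit Types (mu : nat -> 'I_6 -> R) (C : chain).

(** Averages of the two tables in [hex_count_at] over the next position: [alpha] when the cut vertex
    is chosen, [beta] when it is avoided. *)
Let alpha : R := 2 * b + c.
Let beta : R := 5 * a + 3 * b + 4 * c.

Lemma mean_indep_at_attach C p (mu : 'I_6 -> R) : attach_law a b c mu ->
  \sum_q mu q * (indep_at (attach C p) q)%:R =
  alpha * (indep_at C p)%:R + beta * (indep_off C p)%:R.
Proof.
have sphereE (k : nat) : \sum_(q | gdist (ord0 : hexagon) q == k) mu q =
    \sum_(q < 6) if minn q (6 - q) == k then mu q else 0.
  by rewrite big_mkcond; apply: eq_bigr => q _; rewrite gdist_hexagon.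
case=> [[_]]; rewrite !sphereE !big_ord_recl !big_ord0 /=.
rewrite !addr0 !add0r => mu1 ha hb hc.
(* Distances 1, 2 and 3 already carry the whole mass [a + b + c = 1]. *)
have -> : mu ord0 = 0 by move: mu1 habc; lra.
rewrite !indep_at_attach /= /alpha /beta -ha -hb -hc !natrD !natrM; ring.
Qed.

(** The starting chain is arbitrary so that induction can condition on the first position. *)
Definition walk_expect mu C m : R :=
  \sum_(w : m.-tuple 'I_6)
    (\prod_(k < m) mu k (tnth w k)) * (num_indep (foldl attach C w))%:R.

Lemma walk_expect0 mu C : walk_expect mu C 0 = (num_indep C)%:R.
Proof. by rewrite /walk_expect big_tuple0 big_ord0 mul1r. Qed.

Lemma walk_expectS mu C m : walk_expect mu C m.+1 =
  \sum_p mu 0%N p * walk_expect (fun k => mu k.+1) (attach C p) m.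
Proof.
rewrite /walk_expect big_tupleS; apply: eq_bigr => p _.
rewrite big_distrr; apply: eq_bigr => w _ /=.
rewrite big_ord_recl mulrA; congr (_ * _ * _).
by apply: eq_bigr => k _; rewrite tnthS.
Qed.

(** With N the total and A the count through the attachment vertex, a step sends N to 13N - 8A and
    A, on average, to [beta] N + ([alpha] - [beta]) A. The pair is the first row of the m-th power
    of this matrix. *)
Fixpoint walk_coef m : R * R :=
  if m is m'.+1 then
    let: (u, v) := walk_coef m' in
    (13 * u + beta * v, (alpha - beta) * v - 8 * u)
  else (1, 0).

Lemma walk_expectE mu C m : (forall k, attach_law a b c (mu k)) ->
  walk_expect mu C m = (walk_coef m).1 * (num_indep C)%:R +
    (walk_coef m).2 * \sum_p mu 0%N p * (indep_at C p)%:R.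
Proof.
elim: m mu C => [|m IHm] mu C hmu.
  by rewrite walk_expect0 /= mul1r mul0r addr0.
rewrite walk_expectS /=; case E : (walk_coef m) => [u v] /=.
(* Total mass 1 moves the first term under the sum over [p], so the identity can be checked for each
   [p]. *)
have -> : (num_indep C)%:R = (\sum_p mu 0%N p) * (num_indep C)%:R.
  by case: (hmu 0%N) => -[_ ->]; rewrite mul1r.
rewrite mulrA big_distrr /= big_distrl /=.
rewrite big_distrr -big_split /=; apply: eq_bigr => p _.
rewrite IHm // E /= mean_indep_at_attach // num_indep_attach.
rewrite (num_indep_split C p) !natrD !natrM; ring.
Qed.

(** Cayley-Hamilton: the matrix has trace [13 + alpha - beta] and determinant
    [13 * alpha - 5 * beta]. *)
Lemma walk_expect_rec mu C m : (forall k, attach_law a b c (mu k)) ->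
  walk_expect mu C m.+2 = (13 + alpha - beta) * walk_expect mu C m.+1
    + (5 * beta - 13 * alpha) * walk_expect mu C m.
Proof.
by move=> hmu; rewrite !walk_expectE //=; case: (walk_coef m) => u v /=; ring.
Qed.

Lemma expected_indep0 mu : expected_indep mu 0 = 1.
Proof.
rewrite /expected_indep big_tuple0 /cactus_prob big_ord0 mul1r.
by rewrite num_indep_empty.
Qed.

Lemma expected_indep1 mu : expected_indep mu 1 = 18.
Proof.
rewrite /expected_indep big_tuple0 /cactus_prob big_ord0 mul1r.
by rewrite num_indep_one_hexagon.
Qed.

Lemma expected_indepE mu m :
  expected_indep mu m.+2 = walk_expect mu two_hexagons m.
Proof.
(* This gives the tuples on the right the length [m.+2 - 2] used on the left. *)
by rewrite -[m in RHS](addnK 2) addn2.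
Qed.

Lemma expected_indep2 mu : expected_indep mu 2 = 194.
Proof.
rewrite expected_indepE walk_expect0 num_indep_attach.
by rewrite indep_at_one_hexagon indep_off_one_hexagon.
Qed.

Lemma expected_indep_rec mu n : (forall k, attach_law a b c (mu k)) ->
  expected_indep mu n.+3 = (13 + alpha - beta) * expected_indep mu n.+2
    + (5 * beta - 13 * alpha) * expected_indep mu n.+1.
Proof.
(* Walks from [two_hexagons] start at index 2, so the instance reaching back to index 1 is checked
   from the values 18 and 194. *)
move=> hmu; case: n => [|n]; last by rewrite !expected_indepE walk_expect_rec.
rewrite expected_indep2 expected_indep1 expected_indepE walk_expectE //=.
rewrite mean_indep_at_attach // num_indep_attach.
by rewrite indep_at_one_hexagon indep_off_one_hexagon natrD !natrM; ring.
Qed.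

End Expectation.

(** * From the recurrence to the generating function *)

Lemma fps_eq_div (R : comUnitRingType) (f g h : fps R) :
  fcoef h 0 \is a GRing.unit -> h * f = g -> f = g / h.
Proof. by move=> hU <-; rewrite mulrAC divrr ?mul1r. Qed.

Theorem theorem5 (R : realType) (a b c : R)
    (ha : 0 <= a) (hb : 0 <= b) (hc : 0 <= c) (habc : a + b + c = 1)
    (mu : nat -> 'I_6 -> R) (hmu : forall k, attach_law a b c (mu k)) :
  indep_gf mu =
    poly_fps (1 + 13 *: 'X - (3 * a) *: 'X - (7 * b) *: 'X - (5 * c) *: 'X
              + (25 * a) *: 'X^2 - (11 * b) *: 'X^2 + (7 * c) *: 'X^2)
  / poly_fps (1 - 5 *: 'X - (3 * a) *: 'X - (7 * b) *: 'X - (5 * c) *: 'X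
              - (25 * a) *: 'X^2 + (11 * b) *: 'X^2 - (7 * c) *: 'X^2).
Proof.
apply: fps_eq_div.
  by rewrite /= !coefE /= !mulr0 !subr0 !addr0 unitr1.
apply: fpsP => -[|[|[|n]]] /=.
- rewrite big_ord1 !coefE /= expected_indep0; ring.
- rewrite !big_ord_recl big_ord0 !coefE /= expected_indep0 expected_indep1; ring.
- rewrite !big_ord_recl big_ord0 !coefE /=.
  rewrite expected_indep0 expected_indep1 expected_indep2.
  have -> : a = 1 - b - c by rewrite -habc; ring.
  ring.
(* The denominator has degree at most 2, so only three terms of the convolution survive; they cancel
   by the recurrence. *)
rewrite 3!big_ord_recl big1 => [|i _]; last first.
  by rewrite !coefE /= !mulr0 !(addr0, subr0) mul0r.
rewrite !coefE /= /bump /= !(subn0, subSS) (expected_indep_rec habc _ _ hmu).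
(* The trace is [13 - 5 * a - b - 3 * c]; it equals [5 + 3 * a + 7 * b + 5 * c] only through
   [a + b + c = 1]. *)
have -> : a = 1 - b - c by rewrite -habc; ring.
ring.
Qed.
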